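(* Let $\xi=(\xi_1,\xi_2,\xi_3)^T\in\mathbb{R}^3$ with $\xi_i>0$ for $1\le i\le3$, let $\Phi(x)=\Delta_{\frac1\xi}S(x)\Delta_\xi x$ for $x\in\mathbb{R}^3$ (the rigid body drift), and let $f_i=\Delta_{\frac1\xi}b_i$ with $b_i\in\mathbb{R}^3$, $i=1,2$. Then $$\mathrm{Span}\{f_1,f_2,\Phi(\alpha f_1+\beta f_2)\mid\alpha,\beta\in\mathbb{R}\}=\mathbb{R}^3$$ if and only if $$\mathrm{Span}\{b_1,b_2,S(\alpha b_1+\beta b_2)\Delta_{\frac1\xi}(\alpha b_1+\beta b_2)\mid\alpha,\beta\in\mathbb{R}\}=\mathbb{R}^3 .$$
   Context: $\Delta_\xi$ is the diagonal matrix with diagonal $\xi$ and $\Delta_{\frac1\xi}=\Delta_\xi^{-1}$. For $x\in\mathbb{R}^3$, $S(x)=\begin{bmatrix}0&x_3&-x_2\\ -x_3&0&x_1\\ x_2&-x_1&0\end{bmatrix}$. The vectors $f_1,f_2$ are linearly independent. *)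

(* Defs.v *)
From HB Require Import structures.
From mathcomp Require Import all_boot all_order all_algebra.
From mathcomp Require Import classical_sets reals.

Set Implicit Arguments.
Unset Strict Implicit.
Unset Printing Implicit Defensive.

Import GRing.Theory.
Local Open Scope classical_set_scope.
Local Open Scope ring_scope.

Definition Delta (R : realType) (xi : 'cV[R]_3) : 'M[R]_3 := diag_mx xi^T.

(* Indices start at 0: the coordinate x_i of the usual notation is
   x (i - 1) 0. *)
Definition Smx (R : realType) (x : 'cV[R]_3) : 'M[R]_3 :=
  let x1 := x 0 0 in let x2 := x 1 0 in let x3 := x 2%:R 0 in
  \matrix_(i < 3, j < 3)
    (nth [::] [:: [::    0;   x3; - x2];
                  [:: - x3;    0;   x1];
                  [::   x2; - x1;    0]] i)`_j.

Definition rigid_body_drift (R : realType) (xi x : 'cV[R]_3) : 'cV[R]_3 :=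
  invmx (Delta xi) *m Smx x *m Delta xi *m x.

(* The library's <<s>> is the span of a finite sequence; the span of an
   arbitrary set A is the union of the spans of its finite families. *)
Definition lin_span (K : fieldType) (V : vectType K) (A : set V) : set V :=
  [set v | exists2 s : seq V, {in s, forall u, A u} & v \in <<s>>%VS].

(* Main.v *)
Require Import Defs.
From mathcomp Require Import all_boot all_order all_algebra.
From mathcomp Require Import classical_sets reals.
From mathcomp Require Import ring.

Import Order.TTheory GRing.Theory.
Local Open Scope classical_set_scope.
Local Open Scope ring_scope.

(** Up to a sign, [S(x) y] is the cross product of [x] and [y], so
    [S(x) y = - S(y) x].  Write [D] for [Delta xi].  At [x = D^-1 b] the drift
    is therefore [D^-1 S(D^-1 b) b = - D^-1 (S(b) D^-1 b)]
    ([rigid_body_driftE]): up to sign, the generators of the first span are the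
    images under [D^-1] of those of the second.  Since [D] is invertible, each
    family is carried to the other, up to nonzero scalars, by a surjective
    linear map ([D] one way, [D^-1] the other), and such a map preserves the
    property of spanning the whole space ([lin_span_full_image]). *)

(** The target generators are allowed to differ from the images by a scalar,
    which absorbs the sign in [rigid_body_driftE]. *)
Lemma lin_span_full_image (K : fieldType) (V W : vectType K)
    (f : {linear V -> W}) (A : set V) (B : set W) :
  (forall w, exists v, f v = w) ->
  (forall u, A u -> exists2 w, B w & f u \in <[w]>%VS) ->
  lin_span A = [set: V] -> lin_span B = [set: W].
Proof.
move=> f_surj fAB spanA; apply/seteqP; split=> // w _.
have [v <-] := f_surj w.
have [s sA vs] : lin_span A v by rewrite spanA.
have [t tB fst] : exists2 t : seq W,
    {in t, forall u, B u} & (<<map (linfun f) s>> <= <<t>>)%VS.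
  elim: s sA {vs} => [|u s IHs] sA; first by exists [::]; rewrite ?subvv.
  have [z zs|t tB fst] := IHs; first by apply: sA; rewrite inE zs orbT.
  have [w' Bw' fuw'] := fAB _ (sA u (mem_head u s)).
  exists (w' :: t); first by move=> z; rewrite inE => /predU1P[->|/tB].
  by rewrite /= !span_cons addvS // -memvE lfunE.
exists t => //; apply: (subvP fst).
by rewrite -limg_span -[f v]lfunE memv_img.
Qed.

Lemma Smx_anticomm (R : realType) (x y : 'cV[R]_3) :
  Smx x *m y = - (Smx y *m x).
Proof.
apply/matrixP => i j; rewrite ord1 !mxE !big_ord_recl !big_ord0 !mxE /=.
have -> : lift ord0 ord0 = 1 :> 'I_3 by apply: val_inj.
have -> : lift ord0 (lift ord0 ord0) = 2%:R :> 'I_3 by apply: val_inj.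
by case: i => [[|[|[|]]]] //= _; ring.
Qed.

Lemma unitmx_Delta (R : realType) (xi : 'cV[R]_3) :
  (forall i, 0 < xi i 0) -> Delta xi \in unitmx.
Proof.
move=> xi_gt0; rewrite unitmxE det_diag unitfE.
by apply/prodf_neq0 => i _; rewrite mxE gt_eqF.
Qed.

Lemma rigid_body_driftE (R : realType) (xi b : 'cV[R]_3) :
  Delta xi \in unitmx ->
  rigid_body_drift xi (invmx (Delta xi) *m b)
    = - (invmx (Delta xi) *m (Smx b *m invmx (Delta xi) *m b)).
Proof.
move=> Du; rewrite /rigid_body_drift -!mulmxA mulKVmx //.
by rewrite [in LHS]Smx_anticomm mulmxN.
Qed.

Theorem mainTheorem5 (R : realType) (xi b1 b2 f1 f2 : 'cV[R]_3)
    (xi_gt0 : forall i : 'I_3, 0 < xi i 0)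
    (f1E : f1 = invmx (Delta xi) *m b1)
    (f2E : f2 = invmx (Delta xi) *m b2)
    (f_free : free [:: f1; f2]) :
  lin_span ([set f1; f2] `|`
      [set v | exists alpha beta : R,
         v = rigid_body_drift xi (alpha *: f1 + beta *: f2)]) = [set: 'cV[R]_3]
  <->
  lin_span ([set b1; b2] `|`
      [set v | exists alpha beta : R,
         v = Smx (alpha *: b1 + beta *: b2) *m invmx (Delta xi)
               *m (alpha *: b1 + beta *: b2)]) = [set: 'cV[R]_3].
Proof.
have Du := unitmx_Delta _ _ xi_gt0.
have combE (a b : R) : a *: f1 + b *: f2
    = invmx (Delta xi) *m (a *: b1 + b *: b2).
  by rewrite f1E f2E mulmxDr -!scalemxAr.
split.
- apply: (lin_span_full_image _ _ _ (mulmx (Delta xi))) => [w|u].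
    by exists (invmx (Delta xi) *m w); rewrite /= mulKVmx.
  case=> [[]->|[a [b ->]]] /=.
  + by exists b1; [left; left | rewrite f1E mulKVmx ?memv_line].
  + by exists b2; [left; right | rewrite f2E mulKVmx ?memv_line].
  + eexists; first by right; exists a, b.
    by rewrite combE rigid_body_driftE // mulmxN mulKVmx // memvN memv_line.
- apply: (lin_span_full_image _ _ _ (mulmx (invmx (Delta xi)))) => [w|u].
    by exists (Delta xi *m w); rewrite /= mulKmx.
  case=> [[]->|[a [b ->]]] /=.
  + by exists f1; [left; left | rewrite f1E memv_line].
  + by exists f2; [left; right | rewrite f2E memv_line].
  + eexists; first by right; exists a, b.
    by rewrite combE rigid_body_driftE // -memvN memv_line.
Qed.
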